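(* Let $K$ be a knotoid in $S^2$. The height $h(K)$ of $K$ is greater than or equal to the maximum degree (in $t$) of the affine index polynomial $P_K(t)$ of $K$.
   Context: A knotoid diagram in $S^2$ is a generic immersion of $[0,1]$ into the oriented sphere $S^2$ whose only singularities are finitely many transversal double points, each endowed with over/under information (classical crossings). The images of $0$ and $1$ (the tail and the head) are distinct from each other and from the crossings, and the diagram is oriented from tail to head. The $\Omega$-moves are the three Reidemeister moves $\Omega_1,\Omega_2,\Omega_3$ performed inside small disks not containing the endpoints (pulling the strand adjacent to an endpoint over or under another strand is not allowed). Two knotoid diagrams in $S^2$ are equivalent if they are related by a finite sequence of $\Omega$-moves and isotopy of $S^2$; a knotoid in $S^2$ is an equivalence class. Height. A shortcut of a knotoid diagram is an arc embedded in $S^2$ connecting the two endpoints, meeting the diagram otherwise transversally and away from its crossings. The height of a knotoid diagram is the minimum, over all shortcuts, of the number of crossings the shortcut makes with the diagram (in its interior). The height $h(K)$ of a knotoid $K$ in $S^2$ is the minimum of the heights of all knotoid diagrams in $S^2$ representing $K$. Affine index polynomial. Let $F(K)$ be the underlying flat diagram of a diagram $K$, obtained by forgetting the over/under information. Its arcs are the edges between consecutive vertices, where the vertices are the flat crossings and the two endpoints. Label the arcs by integers: the first arc (starting at the tail) has label $0$. At each flat crossing, drawn with both strands oriented upwards, the strand going from bottom right to top left has its label increased by $1$ and the strand going from bottom left to top right has its label decreased by $1$. For a crossing $c$ let $a$ and $b$ be the labels of the left and right incoming arcs at the corresponding flat crossing, and set $w_+(c)=a-(b+1)$, $w_-(c)=b-(a-1)$.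 The weight $w_K(c)$ is $w_+(c)$ if $c$ is a positive crossing and $w_-(c)$ if $c$ is a negative crossing. Then $$P_K(t)=\sum_c \mathrm{sgn}(c)\,(t^{w_K(c)}-1)\in\mathbb{Z}[t,t^{-1}],$$ the sum over all classical crossings, with $\mathrm{sgn}(c)=\pm1$ the sign of $c$. $P_K(t)$ depends only on the knotoid. If $P_K(t)=0$, its maximum degree is taken to be $0$. *)

(* Defs.v *)
From Stdlib Require Import Relation_Operators Relation_Definitions.
From HB Require Import structures.
From mathcomp Require Import all_boot all_order all_algebra.
From mathcomp Require Import generic_quotient.
From mathcomp Require Import finmap monalg boolp.

Set Implicit Arguments.
Unset Strict Implicit.
Unset Printing Implicit Defensive.

Import GRing.Theory.
Local Open Scope quotient_scope.
Local Open Scope ring_scope.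

(* A knotoid diagram in S^2, considered up to isotopy of S^2, is encoded by its
   signed Gauss code: the sequence of the crossing passages met when going from
   the tail to the head.  A passage records the name of the crossing, whether
   the strand passes over, and whether the crossing is positive.  The code
   determines the cyclic order of the half-edges around every crossing, hence a
   cellular embedding of the underlying graph in a closed oriented surface; the
   diagrams in S^2 are the codes for which this surface has genus 0.  Two
   diagrams are isotopic iff their codes differ by a renaming of the crossings
   (orientation-preserving homeomorphisms of S^2 are isotopic to the
   identity). *)

Definition letter := (nat * bool * bool)%type.
Definition name (x : letter) : nat := x.1.1.
Definition over (x : letter) : bool := x.1.2.
Definition positive (x : letter) : bool := x.2.

Definition rename (f : nat -> nat) (x : letter) : letter :=
  (f (name x), over x, positive x).

(* The other passage through the same crossing. *)
Definition mate (x : letter) : letter := (name x, ~~ over x, positive x).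

(* Drawing the flat crossing with both strands oriented upwards, [rightward x]
   says that the strand of the passage [x] goes from bottom left to top right.
   At a positive crossing this is the over strand, at a negative crossing the
   under strand. *)
Definition rightward (x : letter) : bool := over x == positive x.

(* Every crossing is met exactly twice, once over and once under, and with the
   same sign. *)
Definition gauss_code (w : seq letter) : bool :=
  uniq [seq (name x, over x) | x <- w] && all (fun x => mate x \in w) w.

(** Planarity *)

(* Edge [i], for 0 <= i <= size w, joins the passages number [i - 1] and [i] of
   [w], where the passages -1 and [size w] stand for the two ends of [w].  The
   dart [(i, true)] is the edge [i] traversed forwards and [(i, false)] is the
   edge [i] traversed backwards. *)
Definition dart (w : seq letter) : Type := ('I_(size w).+1 * bool)%type.

Definition passage (w : seq letter) (i : nat) : letter :=
  nth (0%N, false, false) w i.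

Definition mate_index (w : seq letter) (i : nat) : nat :=
  index (mate (passage w i)) w.

(* The dart obtained by turning left when arriving at the passage [i], forwards
   or backwards according to [fwd]. *)
Definition turn_left (w : seq letter) (i : nat) (fwd : bool) : dart w :=
  if rightward (passage w i) == fwd then (inord (mate_index w i).+1, true)
  else (inord (mate_index w i), false).

(* The dart following [d] on the boundary of the face on the left of [d].  If
   [closed] is false the ends of [w] are two distinct univalent vertices; if
   [closed] is true they are one and the same bivalent vertex. *)
Definition face (closed : bool) (w : seq letter) (d : dart w) : dart w :=
  if d.2 then
    if d.1 == size w :> nat then
      if closed then (ord0, true) else (ord_max, false)
    else turn_left w d.1 true
  else
    if d.1 == 0%N :> nat then
      if closed then (ord_max, false) else (ord0, true)
    else turn_left w d.1.-1 false.

(* Euler's formula V - E + F = 2, for a Gauss code with n = (size w)./2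
   crossings: E = 2n + 1, and V = n + 2 for an arc, V = n + 1 for a closed
   curve. *)
Definition planar_arc (w : seq letter) : bool :=
  fcard (face false (w := w)) predT == (size w)./2.+1.

Definition planar_loop (w : seq letter) : bool :=
  fcard (face true (w := w)) predT == (size w)./2.+2.

Definition diagram := {w : seq letter | gauss_code w && planar_arc w}.

(** Equivalence of diagrams *)

(* The edges number [i], [j] and [k] of the arc [w] bound a triangular face. *)
Definition triangle (w : seq letter) (i j k : nat) : Prop :=
  exists c : seq (dart w),
    fcycle (face false (w := w)) c /\
    perm_eq [seq val d.1 | d <- c] [:: i; j; k].

(* In [omega1] and [omega2] the monogon and the bigon created by the move are
   faces for all choices of signs allowed below.  In [omega3] one strand must be
   above the two others; the relative position of the latter is then that of a
   middle and of a bottom strand. *)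
Inductive omega : seq letter -> seq letter -> Prop :=
| omega_rename (f : nat -> nat) w of injective f : omega w (map (rename f) w)
| omega1 u v x : omega (u ++ v) (u ++ [:: x; mate x] ++ v)
| omega2_direct u v z x y of over x = over y & positive x != positive y :
    omega (u ++ v ++ z)
          (u ++ [:: x; y] ++ v ++ [:: mate x; mate y] ++ z)
| omega2_reverse u v z x y of over x = over y & positive x != positive y :
    omega (u ++ v ++ z)
          (u ++ [:: x; y] ++ v ++ [:: mate y; mate x] ++ z)
| omega3 u1 u2 u3 u4 x1 x2 y1 y2 z1 z2
    (w := u1 ++ [:: x1; x2] ++ u2 ++ [:: y1; y2] ++ u3 ++ [:: z1; z2] ++ u4)
    (i := (size u1).+1)
    (j := (size (u1 ++ [:: x1; x2] ++ u2)).+1)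
    (k := (size (u1 ++ [:: x1; x2] ++ u2 ++ [:: y1; y2] ++ u3)).+1)
    of triangle w i j k
    & [|| over x1 && over x2, over y1 && over y2 | over z1 && over z2] :
    omega w
      (u1 ++ [:: x2; x1] ++ u2 ++ [:: y2; y1] ++ u3 ++ [:: z2; z1] ++ u4).

Definition equivalent : diagram -> diagram -> Prop :=
  clos_refl_sym_trans diagram (fun D D' => omega (val D) (val D')).

Definition equivalentb (D D' : diagram) : bool := `[< equivalent D D' >].

Lemma equivalentb_refl : reflexive equivalentb.
Proof. by move=> D; apply/asboolP; apply: rst_refl. Qed.

Lemma equivalentb_sym : symmetric equivalentb.
Proof. by move=> D D'; apply/asboolP/asboolP; apply: rst_sym. Qed.

Lemma equivalentb_trans : transitive equivalentb.
Proof.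
move=> D2 D1 D3 /asboolP h12 /asboolP h23; apply/asboolP.
exact: rst_trans h12 h23.
Qed.

Canonical equivalent_equiv :=
  EquivRel equivalentb equivalentb_refl equivalentb_sym equivalentb_trans.

Definition knotoid := {eq_quot equivalent_equiv}.

Definition represents (D : diagram) (K : knotoid) : Prop := K = \pi_knotoid D.

(** Height *)

(* The shortcut, run from the head to the tail, closes up the diagram [D] into a
   closed curve on S^2, whose Gauss code is [w ++ s]: [w] is [D] with the
   additional crossings made with the shortcut, and [s] is the sequence of the
   passages of the shortcut.  Declaring that the shortcut passes under
   everything only fixes a convention for the new crossings, and expresses that
   it has no self-crossing. *)
Definition shortcut (D : diagram) (w s : seq letter) : Prop :=
  [/\ gauss_code (w ++ s), planar_loop (w ++ s),
      all (fun x => ~~ over x) s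
    & [seq x <- w | mate x \notin s] = val D].

Definition is_minimum (A : nat -> Prop) (m : nat) : Prop :=
  A m /\ forall n, A n -> (m <= n)%N.

Definition is_diagram_height (D : diagram) : nat -> Prop :=
  is_minimum (fun m => exists w s, shortcut D w s /\ size s = m).

Definition is_height (K : knotoid) : nat -> Prop :=
  is_minimum (fun m => exists D, represents D K /\ is_diagram_height D m).

(** Affine index polynomial *)

(* The label of the arc arriving at the passage number [i]. *)
Definition arc_label (w : seq letter) (i : nat) : int :=
  \sum_(x <- take i w) (if rightward x then -1 else 1).

Definition incoming_label (w : seq letter) (x : letter) : int :=
  arc_label w (index x w).

(* The strand arriving from the left is the one going to the right. *)
Definition left_label (w : seq letter) (x : letter) : int :=
  incoming_label w (if rightward x then x else mate x).

Definition right_label (w : seq letter) (x : letter) : int :=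
  incoming_label w (if rightward x then mate x else x).

Definition weight (w : seq letter) (x : letter) : int :=
  let a := left_label w x in
  let b := right_label w x in
  if positive x then a - (b + 1) else b - (a - 1).

Definition crossing_sign (x : letter) : int := if positive x then 1 else -1.

(* The Laurent polynomials with integer coefficients, as formal combinations of
   exponents: [<< k >>] is the monomial t^k. *)
Definition laurent := {malg int[int]}.

(* Each crossing is counted once, at its over passage. *)
Definition affine_index_polynomial (D : diagram) : laurent :=
  \sum_(x <- val D | over x)
    crossing_sign x *: (<< weight (val D) x >> - << 0 >>).

Definition max_degree (p : laurent) : int :=
  let s : seq int := msupp p in \big[Order.max/head 0 s]_(k <- s) k.

(* Main.v *)
From Pilot Require Import Defs.
From HB Require Import structures.
From mathcomp Require Import all_boot all_order all_algebra.
From mathcomp Require Import generic_quotient finmap monalg boolp zify ring lra.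
(* Again, since the [over] of ssreflect now hides that of [Defs]. *)
Import Pilot.Defs.

Set Implicit Arguments.
Unset Strict Implicit.
Unset Printing Implicit Defensive.

Import Order.TTheory GRing.Theory Num.Theory.
Local Open Scope ring_scope.

(* The polynomial is computed from the labels, which are partial sums of
   [turn_sign], and only the third Reidemeister move needs its geometry: along
   the boundary of the triangle, the two labels at a corner are shifted by the
   same amount.  So it suffices to bound the weights of a diagram D of minimal
   height.  Closing D up by a shortcut gives a closed curve W on the sphere.
   Its crossings have weight 0, as the weight of x is the intersection number of
   the loop of W at x with the rest of W, and every cycle on the sphere is a
   boundary.  Forgetting the crossings with the shortcut changes the partial
   sum between two passages by at most the number of these crossings. *)

(** * Turn signs, labels and weights *)

Definition turn_sign (x : letter) : int := if rightward x then -1 else 1.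

Lemma mateK : involutive mate.
Proof. by case=> [[a []] c]. Qed.

Lemma mate_neq x : mate x != x.
Proof. by apply/eqP; case: x => [[a []] c]. Qed.

Lemma rightward_mate x : rightward (mate x) = ~~ rightward x.
Proof. by case: x => [[a []] []]. Qed.

Lemma turn_sign_mate x : turn_sign (mate x) = - turn_sign x.
Proof.
by rewrite /turn_sign rightward_mate; case: rightward; rewrite ?opprK.
Qed.

Lemma turn_sign_over x : over x -> turn_sign x = - crossing_sign x.
Proof. by case: x => [[a []] []]. Qed.

Lemma incoming_label_nil y : incoming_label [::] y = 0.
Proof. by rewrite /incoming_label /arc_label big_nil. Qed.

Lemma incoming_label_cons x w y :
  incoming_label (x :: w) y =
  if x == y then 0 else turn_sign x + incoming_label w y.
Proof.
rewrite /incoming_label /arc_label /=; case: eqP => _; first by rewrite big_nil.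
by rewrite big_cons.
Qed.

Lemma incoming_label_cat u v y :
  incoming_label (u ++ v) y =
  if y \in u then incoming_label u y
  else \sum_(x <- u) turn_sign x + incoming_label v y.
Proof.
elim: u => [|x u IH] /=; first by rewrite big_nil add0r.
rewrite !incoming_label_cons IH inE [y == x]eq_sym big_cons.
by case: eqP => //= _; case: ifP => //; rewrite addrA.
Qed.

(** The over strand is the rightward one at a positive crossing and the leftward one at a negative
    crossing, so [w_+] and [w_-] become one formula when read from the over passage. *)
Lemma weight_over w x : over x ->
  weight w x =
  incoming_label w x - incoming_label w (mate x) - crossing_sign x.
Proof.
case: x => [[a []] []] // _; rewrite /weight /left_label /right_label /=.
  by rewrite /crossing_sign /= opprD addrA.
by rewrite /crossing_sign /= opprB opprK addrA addrAC.
Qed.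

Lemma gauss_code_uniq w : gauss_code w -> uniq w.
Proof. by case/andP=> /map_uniq. Qed.

Lemma gauss_code_mate w x : gauss_code w -> (mate x \in w) = (x \in w).
Proof.
case/andP=> _ /allP mw; apply/idP/idP => /mw //.
by rewrite mateK.
Qed.

(** * Invariance under renaming and the first two Reidemeister moves *)

Definition index_sum (w : seq letter) : laurent :=
  \sum_(x <- w | over x)
    crossing_sign x *: (<< weight w x >> - << 0 >>).

Lemma index_sum_rename (f : nat -> nat) w : injective f ->
  index_sum (map (rename f) w) = index_sum w.
Proof.
move=> f_inj.
have rI : injective (rename f).
  case=> [[a b] c] [[a' b'] c'] [] /f_inj.
  by rewrite /name /over /positive /= => -> -> ->.
have lab y :
    incoming_label (map (rename f) w) (rename f y) = incoming_label w y.
  elim: w => [|x w IH] /=; first by rewrite !incoming_label_nil.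
  by rewrite !incoming_label_cons IH (inj_eq rI).
rewrite /index_sum big_map; apply: eq_bigr => x xo.
by rewrite !weight_over // lab (lab (mate x)).
Qed.

(** Common pattern of the moves that create crossings: [r] lists the new passages, the old labels
    survive, and the new terms cancel among themselves. *)
Lemma index_sum_insert w w' r : gauss_code w' -> perm_eq w' (r ++ w) ->
  (forall y, y \in r -> mate y \in r) ->
  (forall y, y \in w -> y \notin r ->
     incoming_label w' y = incoming_label w y) ->
  \sum_(x <- r | over x)
    crossing_sign x *: (<< weight w' x >> - << 0 >> : laurent) = 0 ->
  index_sum w = index_sum w'.
Proof.
move=> gw' pw rm lab r0.
rewrite /index_sum (perm_big _ pw) big_cat /= r0 add0r.
have : uniq (r ++ w) by rewrite -(perm_uniq pw) gauss_code_uniq.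
rewrite cat_uniq => /and3P[_ /hasPn rw _].
rewrite big_seq_cond [RHS]big_seq_cond; apply: eq_bigr => y /andP[yw yo].
have yr := rw _ yw.
have myr : mate y \notin r by apply: contra yr => /rm; rewrite mateK.
have : mate y \in w'.
  by rewrite gauss_code_mate // (perm_mem pw) mem_cat yw orbT.
rewrite (perm_mem pw) mem_cat (negPf myr) /= => myw.
by rewrite !weight_over // !lab.
Qed.

(** The two turns along the kink are opposite, so later labels are unchanged. The two labels at the
    new crossing differ by exactly its sign, so its weight is 0. *)
Lemma index_sum_omega1 u v x : gauss_code (u ++ [:: x; mate x] ++ v) ->
  index_sum (u ++ v) = index_sum (u ++ [:: x; mate x] ++ v).
Proof.
move=> gw; apply: (index_sum_insert (r := [:: x; mate x])) => //.
- by rewrite perm_catCA.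
- by move=> y; rewrite !inE => /orP[] /eqP ->; rewrite ?mateK eqxx ?orbT.
- move=> y _; rewrite !inE negb_or => /andP[yx ymx].
  rewrite /= !incoming_label_cat /= !incoming_label_cons ![_ == y]eq_sym.
  rewrite (negPf yx) (negPf ymx) turn_sign_mate; case: ifP => // _; ring.
have := gauss_code_uniq gw; rewrite cat_uniq => /and3P[_ /hasPn /= xu _].
have /xu/negPf xu1 : x \in x :: mate x :: v by rewrite inE eqxx.
have /xu/negPf xu2 : mate x \in x :: mate x :: v by rewrite !inE eqxx orbT.
have w0 y : over y -> (y == x) || (y == mate x) ->
    weight (u ++ [:: x; mate x] ++ v) y = 0.
  move=> yo /orP[] /eqP ye; rewrite weight_over // -[crossing_sign y]opprK.
    rewrite -(turn_sign_over yo) {y yo}ye.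
    rewrite /= !incoming_label_cat /= !incoming_label_cons xu1 xu2.
    rewrite !eqxx [x == _]eq_sym (negPf (mate_neq x)); ring.
  rewrite -(turn_sign_over yo) {y yo}ye mateK turn_sign_mate.
  rewrite /= !incoming_label_cat /= !incoming_label_cons xu1 xu2.
  rewrite !eqxx [x == _]eq_sym (negPf (mate_neq x)); ring.
rewrite big_seq_cond big1 // => y /andP[]; rewrite !inE => yx yo.
by rewrite w0 // subrr scaler0.
Qed.

Lemma crossing_sign_mate x : crossing_sign (mate x) = crossing_sign x.
Proof. by []. Qed.

Lemma turn_sign_opp x y : over x = over y -> positive x != positive y ->
  turn_sign y = - turn_sign x.
Proof.
by rewrite /turn_sign /rightward => ->; case: over; do 2!case: positive.
Qed.

Lemma crossing_sign_opp x y : positive x != positive y ->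
  crossing_sign y = - crossing_sign x.
Proof. by rewrite /crossing_sign; do 2!case: positive. Qed.



Lemma incoming_label_prefix u v y : uniq (u ++ y :: v) ->
  incoming_label (u ++ y :: v) y = \sum_(x <- u) turn_sign x.
Proof.
rewrite cat_uniq /= => /and3P[_ /norP[/negPf yu _] _].
by rewrite incoming_label_cat yu incoming_label_cons eqxx addr0.
Qed.

(** Each side of the bigon makes two opposite turns, so the other labels are unchanged. The two new
    crossings have equal weights and opposite signs. The disjunction on [p] and [q] covers the
    direct and the reverse move. *)
Lemma index_sum_omega2 u v z x y p q :
  over x = over y -> positive x != positive y ->
  (p = mate x /\ q = mate y) \/ (p = mate y /\ q = mate x) ->
  gauss_code (u ++ [:: x; y] ++ v ++ [:: p; q] ++ z) ->
  index_sum (u ++ v ++ z) = index_sum (u ++ [:: x; y] ++ v ++ [:: p; q] ++ z).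
Proof.
move=> oxy sxy pq gw; set w := u ++ _ in gw *.
have tyx : turn_sign y = - turn_sign x by apply: turn_sign_opp.
have tqp : turn_sign q = - turn_sign p.
  by case: pq => -[-> ->]; rewrite !turn_sign_mate tyx !opprK.
apply: (index_sum_insert (r := [:: x; y; p; q])) => //.
- rewrite perm_catCA -[X in perm_eq _ X]/([:: x; y] ++ [:: p; q] ++ _).
  by rewrite perm_cat2l perm_sym perm_catCA perm_cat2l perm_catCA.
- move=> a; rewrite !inE.
  by case: pq => -[-> ->] /or4P[] /eqP ->; rewrite ?mateK eqxx ?orbT.
- move=> a _; rewrite !inE !negb_or => /and4P[ax ay ap aq].
  rewrite /w /= !incoming_label_cat /= !incoming_label_cons !incoming_label_cat.
  rewrite !incoming_label_cons ![_ == a]eq_sym.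
  rewrite (negPf ax) (negPf ay) (negPf ap) (negPf aq).
  by case: ifP => // _; case: ifP => // _; rewrite tyx ?tqp; ring.
have uw := gauss_code_uniq gw.
have lx : incoming_label w x = \sum_(x <- u) turn_sign x.
  exact: incoming_label_prefix.
have ly : incoming_label w y = \sum_(x <- u ++ [:: x]) turn_sign x.
  have ew : w = (u ++ [:: x]) ++ y :: v ++ [:: p; q] ++ z by rewrite /w -catA.
  by rewrite ew in uw *; apply: incoming_label_prefix.
have lp : incoming_label w p = \sum_(x <- u ++ [:: x; y] ++ v) turn_sign x.
  have ew : w = (u ++ [:: x; y] ++ v) ++ p :: q :: z by rewrite /w -!catA.
  by rewrite ew in uw *; apply: incoming_label_prefix.
have lq : incoming_label w q =
          \sum_(x <- u ++ [:: x; y] ++ v ++ [:: p]) turn_sign x.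
  have ew : w = (u ++ [:: x; y] ++ v ++ [:: p]) ++ q :: z.
    by rewrite /w /= -!catA /= -catA.
  by rewrite ew in uw *; apply: incoming_label_prefix.
rewrite !(big_cat, big_cons, big_nil) /= ?(addr0, add0r) in lx ly lp lq.
have syx := crossing_sign_opp sxy.
have cancel a b : crossing_sign b = - crossing_sign a ->
    weight w a = weight w b ->
    crossing_sign a *: (<< weight w a >> - << 0 >>) +
    (crossing_sign b *: (<< weight w b >> - << 0 >>) + 0) = 0 :> laurent.
  by move=> -> ->; rewrite addr0 scaleNr subrr.
have [op oq] : over p = ~~ over x /\ over q = ~~ over x.
  by case: pq => -[-> ->]; split=> //; rewrite oxy.
rewrite !big_cons big_nil -oxy op oq.
(* The over passages of the two new crossings are [x], [y] or else [p], [q]. *)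
case ox: (over x) => /=; apply: cancel => //.
- rewrite !weight_over -?oxy // syx opprK.
  have := turn_sign_over ox; case: pq => -[ep eq]; rewrite -ep -eq lx ly lp lq;
    by rewrite ep turn_sign_mate ?tyx => ->; ring.
- by case: pq => -[-> ->]; rewrite !crossing_sign_mate syx ?opprK.
- have sign a : over a -> crossing_sign a = - turn_sign a.
    by move/turn_sign_over->; rewrite opprK.
  rewrite !weight_over ?(sign p) ?(sign q) ?op ?oq ?ox // lp lq tqp.
  case: pq => -[ep eq].
    have [-> ->] : mate p = x /\ mate q = y by rewrite ep eq !mateK.
    by rewrite lx ly ep turn_sign_mate tyx; ring.
  have [-> ->] : mate p = y /\ mate q = x by rewrite ep eq !mateK.
  by rewrite lx ly ep turn_sign_mate tyx; ring.
Qed.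

(** * The third Reidemeister move *)

Definition first_passage w (d : dart w) : letter :=
  passage w (if d.2 then d.1.-1 else d.1).
Definition last_passage w (d : dart w) : letter :=
  passage w (if d.2 then d.1 : nat else d.1.-1).
Local Arguments passage : simpl never.
Definition direction w (d : dart w) : int := if d.2 then 1 else -1.

Lemma passage_mate_index w i : gauss_code w -> (i < size w)%N ->
  passage w (mate_index w i) = mate (passage w i).
Proof.
move=> gw iw; rewrite /passage /mate_index nth_index //.
by rewrite gauss_code_mate // mem_nth.
Qed.

Lemma mate_index_lt w i : gauss_code w -> (i < size w)%N ->
  (mate_index w i < size w)%N.
Proof.
by move=> gw iw; rewrite /mate_index index_mem gauss_code_mate // mem_nth.
Qed.

(** At a left turn, whether the face boundary keeps or reverses its direction relative to the curve
    is decided by which strand is rightward. *)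
Lemma face_corner w (d : dart w) : gauss_code w -> (0 < d.1 < size w)%N ->
  first_passage (face false d) = mate (last_passage d) /\
  turn_sign (last_passage d) = - (direction d * direction (face false d)).
Proof.
move=> gw /andP[d0 dw].
have -> : face false d = turn_left w (if d.2 then d.1 : nat else d.1.-1) d.2.
  rewrite /face; case: d d0 dw => d [] /= d0 dw; first by rewrite ltn_eqF.
  by rewrite gtn_eqF.
have lw : ((if d.2 then d.1 : nat else d.1.-1) < size w)%N.
  by case: d.2 => //; apply: leq_ltn_trans (leq_pred _) dw.
rewrite /last_passage; move: {d0 dw} (if d.2 then _ else _) lw => a aw.
have mw := mate_index_lt gw aw.
rewrite /turn_left /turn_sign /first_passage /direction.
case: d.2; case: rightward => /=; rewrite inordK ?ltnS // 1?ltnW //=;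
  by rewrite passage_mate_index.
Qed.

(** [shift] is the change of a label when the two passages at the ends of each edge are exchanged.
    At the corner between two edges, [face_corner] applied around the triangle turns both shifts
    into minus the direction of the third edge. *)
Lemma triangle_shift w (c : seq (dart w)) (shift : letter -> int) :
  gauss_code w -> size c = 3 -> fcycle (face false (w := w)) c ->
  (forall d, d \in c -> (0 < d.1 < size w)%N) ->
  (forall d, d \in c ->
     shift (first_passage d) = direction d * turn_sign (last_passage d) /\
     shift (last_passage d) = - direction d * turn_sign (first_passage d)) ->
  forall d, d \in c ->
    shift (mate (first_passage d)) = shift (first_passage d) /\
    shift (mate (last_passage d)) = shift (last_passage d).
Proof.
case: c => [|d1 [|d2 [|d3 []]]] // gw _ /= /and4P[/eqP f1 /eqP f2 /eqP f3 _].
move=> inner sh.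
have dd (d : dart w) : direction d * direction d = 1.
  by rewrite /direction; case: d.2.
have corner d d' d'' : d \in [:: d1; d2; d3] -> d' \in [:: d1; d2; d3] ->
    d'' \in [:: d1; d2; d3] ->
    face false d = d' -> face false d' = d'' -> face false d'' = d ->
    shift (mate (last_passage d)) = shift (last_passage d) /\
    shift (mate (first_passage d')) = shift (first_passage d').
  move=> dc dc' dc'' e e' e''.
  have [+ t] := face_corner gw (inner _ dc).
  have [_ t'] := face_corner gw (inner _ dc').
  have [m t''] := face_corner gw (inner _ dc'').
  rewrite e e' e'' in t t' t'' m * => m'; rewrite m' mateK -m'.
  have -> : shift (first_passage d') = shift (last_passage d); last by [].
  rewrite (sh _ dc').1 (sh _ dc).2 t' m turn_sign_mate t''.
  rewrite mulrN mulrA dd mul1r opprK mulNr [_ * direction d]mulrC mulrA dd.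
  by rewrite mul1r.
have c1 : d1 \in [:: d1; d2; d3] by rewrite inE eqxx.
have c2 : d2 \in [:: d1; d2; d3] by rewrite !inE eqxx orbT.
have c3 : d3 \in [:: d1; d2; d3] by rewrite !inE eqxx !orbT.
have [a1 b2] := corner _ _ _ c1 c2 c3 f1 f2 f3.
have [a2 b3] := corner _ _ _ c2 c3 c1 f2 f3 f1.
have [a3 b1] := corner _ _ _ c3 c1 c2 f3 f1 f2.
by move=> d; rewrite !inE => /or3P[] /eqP ->.
Qed.

Lemma incoming_label_swap u u' v v' x y :
  uniq (u ++ [:: x; y] ++ v) -> uniq (u' ++ [:: y; x] ++ v') ->
  \sum_(a <- u) turn_sign a = \sum_(a <- u') turn_sign a ->
  incoming_label (u' ++ [:: y; x] ++ v') x -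
    incoming_label (u ++ [:: x; y] ++ v) x = turn_sign y /\
  incoming_label (u' ++ [:: y; x] ++ v') y -
    incoming_label (u ++ [:: x; y] ++ v) y = - turn_sign x.
Proof.
move=> uw uw' e.
rewrite (incoming_label_prefix uw) (incoming_label_prefix uw').
have -> : u ++ [:: x; y] ++ v = (u ++ [:: x]) ++ y :: v by rewrite -catA.
have -> : u' ++ [:: y; x] ++ v' = (u' ++ [:: y]) ++ x :: v' by rewrite -catA.
rewrite !incoming_label_prefix -?catA // !big_cat !big_cons !big_nil e /=.
by split; ring.
Qed.

Lemma incoming_label_skip u v p q y : y != p -> y != q ->
  incoming_label (u ++ [:: p; q] ++ v) y =
  if y \in u then incoming_label u y
  else \sum_(x <- u) turn_sign x +
       (turn_sign p + turn_sign q + incoming_label v y).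
Proof.
move=> yp yq; rewrite incoming_label_cat /= !incoming_label_cons.
rewrite [p == y]eq_sym [q == y]eq_sym (negPf yp) (negPf yq).
by rewrite -(addrA (turn_sign p)).
Qed.

Lemma passage_pair u v p q (w := u ++ [:: p; q] ++ v) :
  [/\ passage w (size u) = p, passage w (size u).+1 = q
    & ((size u).+1 < size w)%N].
Proof.
rewrite /w /passage; split.
- by rewrite nth_cat ltnn subnn.
- by rewrite nth_cat ltnNge leqnSn subSn // subnn.
- by rewrite !size_cat /= addnS ltnS -addn1 leq_add2l.
Qed.

(** A weight depends only on the difference of the two labels at a crossing, and the move shifts
    both by the same amount: by 0 away from the triangle, and by [triangle_shift] at its corners. *)
Lemma index_sum_omega3 u1 u2 u3 u4 x1 x2 y1 y2 z1 z2
    (w := u1 ++ [:: x1; x2] ++ u2 ++ [:: y1; y2] ++ u3 ++ [:: z1; z2] ++ u4)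
    (w' := u1 ++ [:: x2; x1] ++ u2 ++ [:: y2; y1] ++ u3 ++ [:: z2; z1] ++ u4) :
  gauss_code w -> gauss_code w' ->
  triangle w (size u1).+1 (size (u1 ++ [:: x1; x2] ++ u2)).+1
    (size (u1 ++ [:: x1; x2] ++ u2 ++ [:: y1; y2] ++ u3)).+1 ->
  index_sum w = index_sum w'.
Proof.
move=> gw gw' [c [fc]].
have sw (p q : letter) : perm_eq [:: p; q] [:: q; p].
  by apply/permP => a /=; rewrite addnA addnAC (addnC (a p)) addnAC.
have pw : perm_eq w w'.
  rewrite /w /w'.
  by do 3!(rewrite perm_cat2l; apply: perm_cat; first exact: sw).
have uw := gauss_code_uniq gw; have uw' := gauss_code_uniq gw'.
pose shift y := incoming_label w' y - incoming_label w y.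
have shift0 y : y \notin [:: x1; x2; y1; y2; z1; z2] -> shift y = 0.
  rewrite !inE !negb_or => /and5P[n1 n2 n3 n4 /andP[n5 n6]].
  rewrite /shift /w /w' !incoming_label_skip //.
  by do 3!(case: ifP => _; first by ring); ring.
set uy := u1 ++ [:: x1; x2] ++ u2; set uz := uy ++ [:: y1; y2] ++ u3.
have -> : u1 ++ [:: x1; x2] ++ u2 ++ [:: y1; y2] ++ u3 = uz.
  by rewrite /uz /uy -!catA.
have ey : w = uy ++ [:: y1; y2] ++ u3 ++ [:: z1; z2] ++ u4.
  by rewrite /w /uy -!catA.
have ez : w = uz ++ [:: z1; z2] ++ u4 by rewrite /w /uz /uy -!catA.
have [sx1 sx2] : shift x1 = turn_sign x2 /\ shift x2 = - turn_sign x1.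
  exact: incoming_label_swap uw uw' erefl.
have [sy1 sy2] : shift y1 = turn_sign y2 /\ shift y2 = - turn_sign y1.
  have ey' : w' = (u1 ++ [:: x2; x1] ++ u2) ++ [:: y2; y1] ++
                  u3 ++ [:: z2; z1] ++ u4 by rewrite /w' -!catA.
  rewrite /shift ey ey' in uw uw' *; apply: (incoming_label_swap uw uw').
  by rewrite !big_cat !big_cons !big_nil /=; ring.
have [sz1 sz2] : shift z1 = turn_sign z2 /\ shift z2 = - turn_sign z1.
  have ez' : w' = (u1 ++ [:: x2; x1] ++ u2 ++ [:: y2; y1] ++ u3) ++
                  [:: z2; z1] ++ u4 by rewrite /w' -!catA.
  rewrite /shift ez ez' in uw uw' *; apply: (incoming_label_swap uw uw').
  by rewrite !big_cat !big_cons !big_nil /=; ring.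
have [px1 px2 wx] := passage_pair u1
  (u2 ++ [:: y1; y2] ++ u3 ++ [:: z1; z2] ++ u4) x1 x2.
have [py1 py2 wy] := passage_pair uy (u3 ++ [:: z1; z2] ++ u4) y1 y2.
have [pz1 pz2 wz] := passage_pair uz u4 z1 z2.
rewrite -/w in px1 px2 wx; rewrite -ey in py1 py2 wy.
rewrite -ez in pz1 pz2 wz => pc.
have edge (d : dart w) : d \in c ->
    [\/ d.1 = (size u1).+1 :> nat, d.1 = (size uy).+1 :> nat
      | d.1 = (size uz).+1 :> nat].
  move=> dc; have : val d.1 \in [seq val d.1 | d <- c] by apply: map_f.
  rewrite (perm_mem pc) !inE => /or3P[] /eqP e;
    by [apply: Or31 | apply: Or32 | apply: Or33].
have {fc} shift_mate : forall d, d \in c ->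
    shift (mate (first_passage d)) = shift (first_passage d) /\
    shift (mate (last_passage d)) = shift (last_passage d).
  apply: triangle_shift fc _ _ => //.
  - by rewrite -(size_map (fun d : dart w => val d.1)) (perm_size pc).
  - by move=> d /edge [] ->.
  - move=> d /edge; rewrite /first_passage /last_passage /direction.
    by case: d.2 => -[] -> /=;
       rewrite ?px1 ?px2 ?py1 ?py2 ?pz1 ?pz2 ?sx1 ?sx2 ?sy1 ?sy2 ?sz1 ?sz2;
       split; lia.
(* All three edges occur in [c], and their ends are the six passages. *)
have shift_in y : y \in [:: x1; x2; y1; y2; z1; z2] ->
    shift (mate y) = shift y.
  have pass e : e \in [:: (size u1).+1; (size uy).+1; (size uz).+1] ->
      shift (mate (passage w e.-1)) = shift (passage w e.-1) /\
      shift (mate (passage w e)) = shift (passage w e).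
    rewrite -(perm_mem pc) => /mapP[d dc ->].
    have := shift_mate _ dc; rewrite /first_passage /last_passage.
    by case: d.2 => -[].
  have [] := pass (size u1).+1 _; rewrite ?inE ?eqxx //= px1 px2 => qx1 qx2.
  have [] := pass (size uy).+1 _; rewrite ?inE ?eqxx ?orbT //=.
  rewrite py1 py2 => qy1 qy2.
  have [] := pass (size uz).+1 _; rewrite ?inE ?eqxx ?orbT //=.
  rewrite pz1 pz2 => qz1 qz2.
  by case/or4P => [|||/or3P[]] /eqP ->.
rewrite /index_sum (perm_big _ pw); apply: eq_bigr => y oy.
suff sy : shift (mate y) = shift y.
  suff -> : weight w y = weight w' y by [].
  move: sy; rewrite /shift !weight_over //; clear; lia.
case: (boolP (y \in [:: x1; x2; y1; y2; z1; z2])) => [/shift_in //|y6].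
case: (boolP (mate y \in [:: x1; x2; y1; y2; z1; z2])) => [/shift_in|my6].
  by rewrite mateK.
by rewrite !shift0.
Qed.

(** * Faces of the closed curve *)

Lemma mate_indexK w i : gauss_code w -> (i < size w)%N ->
  mate_index w (mate_index w i) = i.
Proof.
move=> gw iw; rewrite {1}/mate_index passage_mate_index // mateK.
by rewrite index_uniq // gauss_code_uniq.
Qed.

Lemma rightward_mate_index w i : gauss_code w -> (i < size w)%N ->
  rightward (passage w (mate_index w i)) = ~~ rightward (passage w i).
Proof. by move=> gw iw; rewrite passage_mate_index // rightward_mate. Qed.

(** Injectivity makes the orbits of [face true] the classes of an equivalence relation, namely the
    faces. The inverse [prev] undoes a left turn. *)
Lemma face_loop_inj w : gauss_code w -> injective (face true (w := w)).
Proof.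
move=> gw.
pose prev (d : dart w) : dart w :=
  if d.2 then
    if d.1 == 0%N :> nat then (ord_max, true)
    else let m := mate_index w d.1.-1 in
         if rightward (passage w m) then (inord m, true)
         else (inord m.+1, false)
  else
    if d.1 == size w :> nat then (ord0, false)
    else let m := mate_index w d.1 in
         if rightward (passage w m) then (inord m.+1, false)
         else (inord m, true).
(* Darts form a finite type, so it suffices that [prev] is a right inverse. *)
apply: (@can_inj _ _ _ prev); apply: canF_sym.
have aux m b : (m < size w)%N ->
    face true (w := w) (if b then (inord m, true) else (inord m.+1, false))
    = turn_left w m b.
  move=> mw; rewrite /face; case: b => /=; rewrite inordK ?ltnS //.
    by rewrite ltn_eqF.
  exact: ltnW.
move=> [e b]; rewrite /prev /=; case: b => /=.
  case: eqP => [e0|/eqP e0].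
    by rewrite /face /= eqxx; congr (_, _); apply: val_inj.
  have ew : (e.-1 < size w)%N by rewrite prednK ?lt0n // -ltnS.
  have mw := mate_index_lt gw ew.
  rewrite aux // /turn_left eqxx mate_indexK // prednK ?lt0n //.
  by congr (_, _); apply: val_inj; rewrite /= inordK.
case: eqP => [e0|/eqP e0].
  by rewrite /face /=; congr (_, _); apply: val_inj; rewrite /= e0.
have ew : (e < size w)%N by have := ltn_ord e; lia.
have mw := mate_index_lt gw ew.
have -> (b : bool) (x y : dart w) :
    (if b then x else y) = (if ~~ b then y else x) by case: b.
rewrite aux // /turn_left.
by case: rightward => /=; rewrite mate_indexK //; congr (_, _);
  apply: val_inj; rewrite /= inordK.
Qed.

(** * Rational 2-chains on the faces and their boundaries *)

Section Potential.

Variables (w : seq letter) (gw : gauss_code w).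
Variables (I : finType) (q : dart w -> I).
Hypothesis q_face : forall d, q (face true d) = q d.
Hypothesis q_surj : forall i, exists d, q d = i.

(** [I] stands for the set of faces and [q] for the face on the left of a dart: [side e true] lies
    to the left of the edge [e] and [side e false] to its right. *)
Let side (e : nat) (fwd : bool) : I := q (inord e, fwd).

(** Each of the four sectors at a crossing is bordered by two edges; the four equations are the four
    left turns. *)
Lemma corner k (m := mate_index w k) : (k < size w)%N ->
    rightward (passage w k) ->
  [/\ side k true = side m.+1 true, side m.+1 false = side k.+1 true,
      side m true = side k false & side k.+1 false = side m false].
Proof.
move=> kw rk; have mw := mate_index_lt gw kw.
have turn i b : (i < size w)%N ->
    q (turn_left w i b) = side (if b then i else i.+1) b.
  move=> iw; rewrite /side -[RHS]q_face /face.
  by case: b => /=; rewrite inordK ?ltnS // 1?ltnW // ltn_eqF.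
split.
- by rewrite -[LHS](turn k true) // /turn_left rk.
- rewrite -[LHS](turn m false) // /turn_left rightward_mate_index //.
  by rewrite rk mate_indexK.
- rewrite -[LHS](turn m true) // /turn_left rightward_mate_index //.
  by rewrite rk mate_indexK.
- by rewrite -[LHS](turn k false) // /turn_left rk.
Qed.

(* The coefficient of the edge [e] in the boundary of the 2-chain [u]. *)
Definition jump (u : I -> rat) (e : nat) : rat :=
  u (side e true) - u (side e false).

(** This is the vanishing of the boundary of a boundary, at one crossing. *)
Lemma jump_mate u k (m := mate_index w k) : (k < size w)%N ->
  jump u m.+1 - jump u m = - (jump u k.+1 - jump u k).
Proof.
move=> kw; have mw := mate_index_lt gw kw.
rewrite /jump; case: (boolP (rightward (passage w k))) => rk.
  by have [-> <- -> ->] := corner kw rk; rewrite -/m; ring.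
have rm : rightward (passage w m) by rewrite rightward_mate_index.
have := corner mw rm; rewrite mate_indexK // => -[-> <- <- ->]; ring.
Qed.

(** Following the left side of the curve past [k], one crosses the half of the other strand lying
    there: its outgoing edge if [k] is rightward, its incoming edge otherwise. *)
Lemma left_step u k (m := mate_index w k) : (k < size w)%N ->
  u (side k.+1 true) - u (side k true) =
  if rightward (passage w k) then - jump u m.+1 else jump u m.
Proof.
move=> kw; have mw := mate_index_lt gw kw.
rewrite /jump; case: (boolP (rightward (passage w k))) => rk.
  by have [-> <- _ _] := corner kw rk; rewrite -/m; ring.
have rm : rightward (passage w m) by rewrite rightward_mate_index.
by have := corner mw rm; rewrite mate_indexK // => -[-> _ -> _]; ring.
Qed.

(** The left side of the whole closed curve returns to its initial face, so the steps telescope to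
    0. *)
Lemma left_total u :
  \sum_(k < size w)
    (if rightward (passage w k) then - jump u (mate_index w k).+1
     else jump u (mate_index w k)) = 0.
Proof.
under eq_bigr => k _ do rewrite -left_step //.
rewrite -(big_mkord xpredT (fun k => u (side k.+1 true) - u (side k true))).
rewrite telescope_sumr // /side.
have -> : (inord (size w), true) = (ord_max, true) :> dart w.
  by congr (_, _); apply: val_inj; rewrite /= inordK.
rewrite -(q_face (ord_max, true)) /face /= eqxx.
have -> : (ord0, true) = (inord 0, true) :> dart w.
  by congr (_, _); apply: val_inj; rewrite /= inordK.
by rewrite subrr.
Qed.

(* A 1-cycle is determined by its coefficient at the edge 0 and by its
   increments at the over passages, those at the under passages being
   opposite. *)
Definition over_index := {k : 'I_(size w) | over (passage w k)}.

Lemma card_over_index : #|{: over_index}| = (size w)./2.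
Proof.
have -> : #|{: over_index}| = count over w.
  rewrite card_sig -sum1_count (big_nth (0%N, false, false)).
  by rewrite big_mkord sum1_card.
have e : count over w = count (predC over) w.
  rewrite -[RHS](count_map mate over).
  suff /permP -> : perm_eq w (map mate w) by [].
  have mI := can_inj mateK.
  apply: uniq_perm; rewrite ?(map_inj_uniq mI) ?gauss_code_uniq // => x.
  by rewrite -{2}[x]mateK (mem_map mI) gauss_code_mate.
by rewrite -(count_predC over w) -e addnn doubleK.
Qed.

(** The boundary map in these coordinates, as a linear map whose rank can be counted; [None] is the
    coordinate at the edge 0. *)
Definition profile (u : {ffun I -> rat^o}) :
    {ffun option over_index -> rat^o} :=
  [ffun j : option over_index =>
     (if j is Some k then jump u (val k).+1 - jump u (val k) else jump u 0)
     : rat^o].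

Lemma profile_linear : linear profile.
Proof.
move=> a u v; apply/ffunP => -[k|]; rewrite !ffunE /jump !ffunE /=.
  by rewrite /GRing.scale /=; ring.
by rewrite /GRing.scale /=; ring.
Qed.
HB.instance Definition _ :=
  GRing.isLinear.Build rat {ffun I -> rat^o} {ffun option over_index -> rat^o}
    _ profile profile_linear.

(** Induction along the curve from the edge 0: the increment at an under passage is minus the one at
    its over mate. *)
Lemma jump_of_profile (f : nat -> rat) u :
  (forall k, (k < size w)%N ->
     f (mate_index w k).+1 - f (mate_index w k) = - (f k.+1 - f k)) ->
  jump u 0 = f 0%N ->
  (forall k : over_index,
     jump u (val k).+1 - jump u (val k) = f (val k).+1 - f (val k)) ->
  forall e, (e <= size w)%N -> jump u e = f e.
Proof.
move=> fm u0 uk; elim=> // e IH ew.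
suff step : jump u e.+1 - jump u e = f e.+1 - f e.
  by rewrite -[LHS](subrK (jump u e)) step (IH (ltnW ew)) subrK.
have mw := mate_index_lt gw ew.
case oe: (over (passage w e)); first exact: (uk (Sub (Ordinal ew) oe)).
have om : over (passage w (mate_index w e)).
  by rewrite passage_mate_index //; apply/negbT.
apply: oppr_inj; rewrite -jump_mate // -fm //.
exact: (uk (Sub (Ordinal mw) om)).
Qed.

(* By Euler's formula there are n + 2 faces, while cycles have n + 1
   coordinates; as only the constant 2-chains have boundary 0, all cycles are
   boundaries. *)
Lemma jump_surj (f : nat -> rat) :
  #|I| = (size w)./2.+2 ->
  (forall k, (k < size w)%N ->
     f (mate_index w k).+1 - f (mate_index w k) = - (f k.+1 - f k)) ->
  exists u, forall e, (e <= size w)%N -> jump u e = f e.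
Proof.
move=> cI fm.
pose L := linfun profile.
(* If the boundary vanishes, [u] agrees on both sides of each edge and, by [left_step], is constant
   along the left of the curve, hence on all faces. *)
have ker1 : (lker L <= <[ [ffun=> 1 : rat^o] ]>)%VS.
  apply/subvP => u; rewrite memv_ker lfunE => /eqP /= pu.
  have u0 : jump u 0 = 0 by have /ffunP/(_ None) := pu; rewrite !ffunE.
  have j0 : forall e, (e <= size w)%N -> jump u e = 0.
    apply: (@jump_of_profile (fun=> 0)) => // k.
    by have /ffunP/(_ (Some k)) := pu; rewrite !ffunE subrr.
  have lr e : (e <= size w)%N -> u (side e true) = u (side e false).
    by move/j0/eqP; rewrite subr_eq0 => /eqP.
  have left0 e : (e <= size w)%N -> u (side e true) = u (side 0 true).
    elim: e => // e IH ew; rewrite -IH; last exact: ltnW.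
    have mw := mate_index_lt gw ew.
    apply/eqP; rewrite -subr_eq0 left_step //.
    by case: ifP => _; rewrite j0 ?oppr0 // ltnW.
  apply/vlineP; exists (u (side 0 true)); apply/ffunP => i; rewrite !ffunE.
  have [[e b] <-] := q_surj i.
  have -> : q (e, b) = side e b by rewrite /side inord_val.
  have ew : (e <= size w)%N by rewrite -ltnS.
  rewrite -(left0 e ew) /GRing.scale /= mulr1.
  by case: b => //; rewrite lr.
(* The rank is at least (n + 2) - 1, the dimension of the target. *)
have full : limg L = fullv.
  apply/eqP; rewrite eqEdim subvf /=.
  have := limg_ker_dim L fullv; rewrite capfv.
  have k1 : (\dim (lker L) <= 1)%N.
    by apply: leq_trans (dimvS ker1) _; rewrite dim_vline; case: (_ != _).
  rewrite !dimvf /dim /= cI card_option card_over_index !muln1; lia.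
pose b : {ffun option over_index -> rat^o} :=
  [ffun j : option over_index =>
     (if j is Some k then f (val k).+1 - f (val k) else f 0%N) : rat^o].
have /memv_imgP[u _] : b \in limg L by rewrite full memvf.
rewrite lfunE => /= /ffunP bu; exists u; apply: jump_of_profile fm _ _.
  by have := bu None; rewrite !ffunE.
by move=> k; have := bu (Some k); rewrite !ffunE.
Qed.

End Potential.

(** The sum is the intersection number of the cycle [f] with the curve pushed to its left. It
    vanishes by [left_total], as [f] is a boundary; the terms are reindexed by [mate_index]. *)
Lemma planar_loop_sum w (f : nat -> rat) : gauss_code w -> planar_loop w ->
  (forall k, (k < size w)%N ->
     f (mate_index w k).+1 - f (mate_index w k) = - (f k.+1 - f k)) ->
  \sum_(k < size w) (if rightward (passage w k) then f k else - f k.+1) = 0.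
Proof.
move=> gw pl fm.
have sym : connect_sym (frel (face true (w := w))).
  exact/fconnect_sym/face_loop_inj.
pose I := {d : dart w | froots (face true (w := w)) d}.
pose q (d : dart w) : I :=
  Sub (froot (face true (w := w)) d) (roots_root sym d).
have q_face d : q (face true d) = q d.
  apply: val_inj; apply/esym/eqP; rewrite (root_connect sym); exact: fconnect1.
have q_surj i : exists d, q d = i.
  by exists (val i); apply: val_inj => /=; apply/eqP; exact: (valP i).
have cI : #|{: I}| = (size w)./2.+2.
  rewrite card_sig -(eqP pl); apply: eq_card => d.
  by rewrite !inE andbT.
have [u fu] := jump_surj gw q_face q_surj cI fm.
have := left_total gw q_face u.
pose m (k : 'I_(size w)) := Ordinal (mate_index_lt gw (ltn_ord k)).
rewrite (reindex_onto m m) /=; last first.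
  by move=> k _; apply: val_inj; rewrite /= mate_indexK.
move=> sum0; rewrite -[RHS]sum0.
apply: eq_big => [k|k _].
  by apply/esym/eqP/val_inj; rewrite /= mate_indexK.
rewrite mate_indexK // rightward_mate_index // !fu //; last exact: ltnW.
by case: rightward.
Qed.

(** * Weights of the crossings of a closed planar curve *)

Lemma arc_label_sum w c :
  \sum_(k < size w | (k < c)%N) turn_sign (passage w k) = arc_label w c.
Proof.
elim: w c => [|x w IH] [|c] /=; rewrite /arc_label.
- by rewrite big_ord0 big_nil.
- by rewrite big_ord0 big_nil.
- by rewrite big_pred0 // take0 big_nil.
rewrite big_mkcond big_ord_recl /= big_cons.
by rewrite -/(arc_label w c) -IH -big_mkcond.
Qed.

Lemma arc_labelS w i : (i < size w)%N ->
  arc_label w i.+1 = arc_label w i + turn_sign (passage w i).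
Proof.
move=> iw; rewrite /arc_label (take_nth (0%N, false, false)) // -cats1 big_cat.
by rewrite big_cons big_nil /= addr0.
Qed.

Lemma planar_weight w x : gauss_code w -> planar_loop w -> x \in w -> over x ->
  weight w x = 0.
Proof.
move=> gw pl xw ox.
pose a := index x w; pose b := index (mate x) w.
have aw : (a < size w)%N by rewrite index_mem.
have bw : (b < size w)%N by rewrite index_mem gauss_code_mate.
have pa : passage w a = x by rewrite /passage nth_index.
have ab : mate_index w a = b by rewrite /mate_index pa.
have ba : mate_index w b = a by rewrite -ab mate_indexK.
(* The loop of the curve at the crossing [x], up to orientation. *)
pose f (e : nat) : rat := (e <= b)%N%:R - (e <= a)%N%:R.
have fS k : f k.+1 - f k = (k == a)%:R - (k == b)%:R.
  rewrite /f !(leq_eqVlt k).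
  by case: ltngtP => _; case: ltngtP => _; rewrite /=; lra.
have mate_a k : (k < size w)%N -> (mate_index w k == a) = (k == b).
  by move=> kw; apply/eqP/eqP => [e|->//]; rewrite -[k](mate_indexK gw) // e.
have mate_b k : (k < size w)%N -> (mate_index w k == b) = (k == a).
  by move=> kw; apply/eqP/eqP => [e|->//]; rewrite -[k](mate_indexK gw) // e.
have := @planar_loop_sum w f gw pl _.
under eq_bigr => k _.
  (* Up to the turn sign the term is [f k], except that [f k.+1] differs from [f k] at the two ends
     [a] and [b] of the loop; the last two summands correct this. *)
  have -> : (if rightward (passage w k) then f k else - f k.+1) =
      (if (k < a.+1)%N then turn_sign (passage w k) else 0)%:~R -
      (if (k < b.+1)%N then turn_sign (passage w k) else 0)%:~R +
      ((if k == b :> nat then (~~ rightward (passage w k))%:R else 0) -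
       (if k == a :> nat then (~~ rightward (passage w k))%:R else 0)).
    have := fS k; rewrite /f /turn_sign !ltnS.
    case: (rightward _); case: (k <= a)%N; case: (k <= b)%N;
      case: (k == a :> nat); case: (k == b :> nat); rewrite /=; lra.
  over.
rewrite big_split /= !sumrB -!rmorph_sum -!big_mkcond !arc_label_sum /=.
rewrite (big_pred1 (Ordinal bw)) // (big_pred1 (Ordinal aw)) //= => sum0.
have {sum0} := sum0 _; rewrite -{2}ab rightward_mate_index // !arc_labelS //.
have tb : turn_sign (passage w b) = - turn_sign (passage w a).
  by rewrite -ab passage_mate_index // turn_sign_mate.
(* The labels just past [a] and [b] contribute twice the turn sign of [x], and the corrections
   remove it once; the remaining copy is minus the crossing sign. *)
have -> : (~~ ~~ rightward (passage w a))%:R - (~~ rightward (passage w a))%:R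
    = (- turn_sign (passage w a))%:~R :> rat.
  by rewrite /turn_sign; case: rightward.
rewrite tb pa -rmorphB -rmorphD => sum0; apply/eqP.
rewrite -(intr_eq0 rat); apply/eqP; rewrite -[RHS]sum0; last first.
  by move=> k kw; rewrite !fS mate_a ?mate_b //; ring.
rewrite weight_over // -[crossing_sign x]opprK -turn_sign_over //.
rewrite -/(arc_label w a) -/(arc_label w b); congr (_%:~R); ring.
Qed.

(** * Shortcuts and the bound on the weights *)

Lemma incoming_label_filter (P : pred letter) w x : P x ->
  incoming_label [seq y <- w | P y] x =
  \sum_(y <- take (index x w) w | P y) turn_sign y.
Proof.
move=> Px; elim: w => [|y w IH] /=; first by rewrite incoming_label_nil big_nil.
case: eqP => [->|/eqP yx].
  by rewrite Px incoming_label_cons eqxx take0 big_nil.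
rewrite big_cons; case: ifP => // _.
by rewrite incoming_label_cons (negPf yx) IH.
Qed.

(** The common prefix cancels, leaving up to sign a sum of at most [count P w] terms equal to 1 or
    -1. *)
Lemma partial_sums_dist (P : pred letter) w i j :
  \sum_(y <- take i w | P y) turn_sign y -
  \sum_(y <- take j w | P y) turn_sign y <= (count P w)%:Z.
Proof.
have bound (s : seq letter) :
    `|\sum_(y <- s | P y) turn_sign y| <= (count P s)%:Z.
  elim: s => [|y s IH] /=; first by rewrite big_nil.
  rewrite big_cons; case: (P y) => //=; rewrite PoszD.
  apply: le_trans (ler_normD _ _) _; apply: lerD IH.
  by rewrite /turn_sign; case: rightward.
elim: w i j => [|x w IH] [|i] [|j];
  rewrite /= ?take0 ?big_nil ?subrr ?subr0 ?sub0r //.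
- have := bound (take j.+1 (x :: w)); rewrite -normrN.
  move=> /(le_trans (ler_norm _)) /le_trans; apply.
  rewrite lez_nat -/(count P (x :: w)).
  by rewrite -{2}[x :: w](cat_take_drop j.+1) count_cat leq_addr.
- have := bound (take i.+1 (x :: w)) => /(le_trans (ler_norm _)).
  move/le_trans; apply; rewrite lez_nat -/(count P (x :: w)).
  by rewrite -{2}[x :: w](cat_take_drop i.+1) count_cat leq_addr.
rewrite !big_cons; have := IH i j; case: ifP => /= _; lia.
Qed.

(** In the closed curve [x] has weight 0 by [planar_weight]. Each label there is the label in [D]
    plus the turns at crossings with the shortcut, so the weight in [D] is a difference of two
    partial sums of such turns. *)
Lemma shortcut_weight (D : diagram) w s x : shortcut D w s ->
  x \in val D -> over x -> weight (val D) x <= (size s)%:Z.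
Proof.
case=> gw pl _ eD xD ox.
have gD : gauss_code (val D) by have /andP[] := valP D.
have mxD : mate x \in val D by rewrite gauss_code_mate.
rewrite -eD !mem_filter in xD mxD.
case/andP: xD => xs xw; case/andP: mxD => mxs mxw.
have xW : x \in w ++ s by rewrite mem_cat xw.
have := planar_weight gw pl xW ox.
rewrite !weight_over // !incoming_label_cat xw mxw -eD.
rewrite !(@incoming_label_filter (fun y => mate y \notin s)) //.
have split i : arc_label w i = \sum_(y <- take i w | mate y \in s) turn_sign y +
    \sum_(y <- take i w | mate y \notin s) turn_sign y.
  by rewrite /arc_label (bigID (fun y => mate y \in s)).
rewrite /incoming_label !split => W0.
(* [mate] sends the passages of [w] across the shortcut injectively into [s]. *)
have crossed : (count (fun y => mate y \in s) w <= size s)%N.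
  rewrite -size_filter -(size_map mate); apply: uniq_leq_size.
    rewrite (map_inj_uniq (can_inj mateK)) filter_uniq //.
    by have := gauss_code_uniq gw; rewrite cat_uniq => /andP[].
  by move=> z /mapP[y]; rewrite mem_filter => /andP[ys _] ->.
have := partial_sums_dist (fun y => mate y \in s) w
  (index (mate x) w) (index x w).
by lia.
Qed.

(** * Invariance under equivalence and the degree bound *)

Lemma index_sum_omega w w' : gauss_code w -> gauss_code w' -> omega w w' ->
  index_sum w = index_sum w'.
Proof.
move=> gw gw' o; case: o gw gw' => {w w'}.
- by move=> f w fI _ _; rewrite index_sum_rename.
- by move=> u v x _; apply: index_sum_omega1.
- by move=> u v z x y oxy sxy _; apply: index_sum_omega2 => //; left.
- by move=> u v z x y oxy sxy _; apply: index_sum_omega2 => //; right.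
move=> u1 u2 u3 u4 x1 x2 y1 y2 z1 z2 w i j k tri _ gw gw'.
exact: index_sum_omega3 gw gw' tri.
Qed.

Lemma equivalent_index_polynomial D D' : equivalent D D' ->
  affine_index_polynomial D = affine_index_polynomial D'.
Proof.
elim=> {D D'} [D D' o|D //|D D' _ -> //|D1 D2 D3 _ -> _ -> //].
by apply: index_sum_omega o; [have /andP[] := valP D | have /andP[] := valP D'].
Qed.

Lemma max_degree_le (p : laurent) (n : nat) :
  (forall k, n%:Z < k -> p@_k = 0) -> max_degree p <= n%:Z.
Proof.
move=> p0.
have le_n k : k \in (msupp p : seq int) -> k <= n%:Z.
  by rewrite leNgt => kp; apply/negP => /p0 /eqP; rewrite mcoeff_eq0 kp.
rewrite /max_degree; move: (msupp p : seq int) le_n => s le_n.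
rewrite big_seq; elim/big_ind: _ => //.
(* The initial value of the maximum is an exponent of the support, or 0 for the zero polynomial; 0
   is below [n] because [n] is natural. *)
- by case: s le_n => [|k s] //= -> //; rewrite inE eqxx.
- by move=> a b an bn; rewrite ge_max an.
Qed.

Theorem theorem4p12 (K : knotoid) (D : diagram) (h : nat) :
  represents D K -> is_height K h ->
  max_degree (affine_index_polynomial D) <= h%:Z.
Proof.
(* [D'] represents [K] and has a shortcut with [h] crossings, listed by [s]. *)
move=> DK [[D' [D'K [[w [s [sc <-]]] _]]] _].
have -> : affine_index_polynomial D = affine_index_polynomial D'.
  apply: equivalent_index_polynomial; apply/asboolP.
  by move: D'K; rewrite DK => /eqmodP.
apply: max_degree_le => k hk.
rewrite /affine_index_polynomial raddf_sum big_seq_cond big1 //.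
move=> x /andP[xD ox].
rewrite /= mcoeffZ mcoeffB !mcoeffU.
(* For [k] above the height, neither the monomial of the weight nor the constant term has degree
   [k]. *)
have -> : (weight (val D') x == k) = false.
  by apply/negbTE; rewrite lt_eqF // (le_lt_trans (shortcut_weight sc xD ox)).
by rewrite lt_eqF ?subrr ?mulr0 // (le_lt_trans _ hk).
Qed.
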